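(* Let $n\ge 2$ be an integer, let $(\theta,\phi)=((\theta_1,\phi_1),\ldots,(\theta_n,\phi_n))\in\Theta^n$ be a strategy profile of the $n$-player quantum volunteer's dilemma, and let $i\in[n]$. Then the payoff $\$_i(\theta,\phi)=\sum_{x\in\{0,1\}^n}\$_i^{\mathrm{VD}}(x)\,p_{\theta,\phi}(x)$ of player $i$ is given by $$\$_i(\theta,\phi)=2\sum_{\substack{x\in\{0,1\}^n\\ x\neq 0^n\\ x_i=0}}p_{\theta,\phi}(x)+\sum_{k=1}^n\left(2-\frac1k\right)\sum_{\substack{x\in\{0,1\}^n\\ x_i=1\\ \mathrm{wt}(x)=k}}p_{\theta,\phi}(x),$$ where for every $x\in\{0,1\}^n$ the probability $p_{\theta,\phi}(x)=\left|\langle\bar x|J^\dagger\left(\bigotimes_{j=1}^nU(\theta_j,\phi_j)\right)J|0\rangle^{\otimes n}\right|^2$ equals $$p_{\theta,\phi}(x)=c_{\theta,\phi}^2(x)+s_{\theta,\phi}^2(x)-2(-1)^{\frac n2+\mathrm{wt}(x)}\,t_{\theta,\phi}(x)\,[n\in2\mathbb Z].$$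
   Context: Notation: $[n]=\{1,\ldots,n\}$; $[P]$ is the Iverson bracket, equal to $1$ if $P$ is true and $0$ otherwise (a term multiplied by a false bracket is read as $0$; in particular the last term of the probability formula is absent when $n$ is odd). For $x\in\{0,1\}^n$, $\mathrm{wt}(x)=|\{i\in[n]:x_i=1\}|$ is the Hamming weight, $\bar x$ is the bitwise complement ($\bar x_i=1-x_i$), and $0^n$ is the all-zeros string. Deterministic (classical, pure-strategy) volunteer's dilemma payoffs: for $x\in\{0,1\}^n$ ($x_i=1$ means player $i$ volunteers, $x_i=0$ means player $i$ abstains), $\$_i^{\mathrm{VD}}(x)=2-\frac1{\mathrm{wt}(x)}$ if $x_i=1$, and $\$_i^{\mathrm{VD}}(x)=2\,[\mathrm{wt}(x)>0]$ if $x_i=0$. Quantum volunteer's dilemma: each player's strategy set is $\Theta=[0,4\pi)\times[0,2\pi)$. Strategy $(\theta_i,\phi_i)\in\Theta$ means that player $i$ applies to qubit $i$ the unitary $$U(\theta_i,\phi_i)=\begin{pmatrix}e^{\mathrm i\phi_i}\cos(\theta_i/2)&\sin(\theta_i/2)\\-\sin(\theta_i/2)&e^{-\mathrm i\phi_i}\cos(\theta_i/2)\end{pmatrix}.$$ The entangling operator on $n$ qubits is $J=e^{-\frac{\mathrm i\pi}{4}Y^{\otimes n}}=\frac1{\sqrt2}(I-\mathrm iY^{\otimes n})$ with $Y=\begin{pmatrix}0&-\mathrm i\\\mathrm i&0\end{pmatrix}$; $|x\rangle$, $x\in\{0,1\}^n$, is the computational basis of $(\mathbb C^2)^{\otimes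 n}$. Auxiliary functions: $$c_{\theta,\phi}(x)=\cos\Big(\sum_{i:x_i=1}\phi_i\Big)\prod_{i:x_i=0}\sin\Big(\frac{\theta_i}2\Big)\prod_{i:x_i=1}\cos\Big(\frac{\theta_i}2\Big),$$ $$s_{\theta,\phi}(x)=\sin\Big(\sum_{i:x_i=0}\phi_i\Big)\prod_{i:x_i=0}\cos\Big(\frac{\theta_i}2\Big)\prod_{i:x_i=1}\sin\Big(\frac{\theta_i}2\Big),$$ $$t_{\theta,\phi}(x)=c_{\theta,\phi}(x)\,s_{\theta,\phi}(x).$$ Empty sums are $0$ and empty products are $1$. *)

(* Defs.v *)
(* MathComp + MathComp-Analysis; complex numbers are R[i] from real-closed. *)
From mathcomp Require Import all_boot all_order all_algebra.
From mathcomp Require Import classical_sets filter reals topology normedtype.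
From mathcomp Require Import sequences exp trigo.
From mathcomp Require Import complex ring lra.
From mathcomp Require boolp.

Set Implicit Arguments.
Unset Strict Implicit.
Unset Printing Implicit Defensive.

Import Order.TTheory GRing.Theory Num.Theory numFieldNormedType.Exports.
Local Open Scope ring_scope.
Local Open Scope complex_scope.
Local Open Scope sesquilinear_scope.

(* Bit strings; [true] is the bit 1.  Players are indexed from 0. *)
Notation bits n := {ffun 'I_n -> bool}.

Definition zeros (n : nat) : bits n := [ffun=> false].

Definition wt (n : nat) (x : bits n) : nat := #|[set i : 'I_n | x i]%SET|.

Definition compl (n : nat) (x : bits n) : bits n := [ffun i => ~~ x i].

Definition vd_payoff (R : realType) (n : nat) (i : 'I_n) (x : bits n) : R :=
  if x i then 2 - (wt x)%:R^-1 else 2 * (0 < wt x)%N%:R.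

Definition in_Theta (R : realType) (theta phi : R) : bool :=
  (0 <= theta < 4 * pi) && (0 <= phi < 2 * pi).

Definition cis (R : realType) (a : R) : R[i] := cos a +i* sin a.

Definition mx2 (C : Type) (a b c d : C) : 'M[C]_2 :=
  \matrix_(r, s) if r == 0 then (if s == 0 then a else b)
                 else (if s == 0 then c else d).

Definition gateU (R : realType) (theta phi : R) : 'M[R[i]]_2 :=
  mx2 (cis phi * (cos (theta / 2))%:C) (sin (theta / 2))%:C
      (- (sin (theta / 2))%:C) (cis (- phi) * (cos (theta / 2))%:C).

Definition pauliY (R : realType) : 'M[R[i]]_2 := mx2 0 (- 'i) 'i 0.

(* Operators on n qubits are matrices whose rows and columns are indexed by
   bit strings through [enum_rank] and its inverse [label]; the order of the
   enumeration is irrelevant. *)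
Definition qdim (n : nat) : nat := #|{: bits n}|.

Definition label (n : nat) (r : 'I_(qdim n)) : bits n := enum_val r.

Definition qubit_index (b : bool) : 'I_2 := if b then 1 else 0.

(* (A_1 (x) ... (x) A_n)_{x,y} = \prod_j (A_j)_{x_j,y_j} *)
Definition tensor (R : realType) (n : nat) (A : 'I_n -> 'M[R[i]]_2) :
    'M[R[i]]_(qdim n) :=
  \matrix_(r, s) \prod_(j < n)
    A j (qubit_index (label r j)) (qubit_index (label s j)).

Definition ket (R : realType) (n : nat) (x : bits n) : 'cV[R[i]]_(qdim n) :=
  delta_mx (enum_rank x) 0.

Definition bra (R : realType) (n : nat) (x : bits n) : 'rV[R[i]]_(qdim n) :=
  (ket R x) ^t*.

(* J = exp (- (i pi / 4) Y^{(x) n}) in closed form; see [cvg_exp_entangler]. *)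
Definition entangler (R : realType) (n : nat) : 'M[R[i]]_(qdim n) :=
  ((Num.sqrt 2)^-1)%:C *: (1%:M - 'i *: tensor (fun _ : 'I_n => pauliY R)).

Definition amplitude (R : realType) (n : nat) (theta phi : 'I_n -> R)
    (x : bits n) : R[i] :=
  (bra R (compl x) *m (entangler R n) ^t*
     *m tensor (fun j => gateU (theta j) (phi j))
     *m entangler R n *m ket R (zeros n)) 0 0.

Definition prob (R : realType) (n : nat) (theta phi : 'I_n -> R)
    (x : bits n) : R :=
  Normc.normc (amplitude theta phi x) ^+ 2.

Definition payoff (R : realType) (n : nat) (theta phi : 'I_n -> R)
    (i : 'I_n) : R :=
  \sum_(x : bits n) vd_payoff R i x * prob theta phi x.

Definition cfun (R : realType) (n : nat) (theta phi : 'I_n -> R)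
    (x : bits n) : R :=
  cos (\sum_(i < n | x i) phi i)
  * (\prod_(i < n | ~~ x i) sin (theta i / 2))
  * \prod_(i < n | x i) cos (theta i / 2).

Definition sfun (R : realType) (n : nat) (theta phi : 'I_n -> R)
    (x : bits n) : R :=
  sin (\sum_(i < n | ~~ x i) phi i)
  * (\prod_(i < n | ~~ x i) cos (theta i / 2))
  * \prod_(i < n | x i) sin (theta i / 2).

Definition tfun (R : realType) (n : nat) (theta phi : 'I_n -> R)
    (x : bits n) : R :=
  cfun theta phi x * sfun theta phi x.

Local Open Scope classical_set_scope.

Lemma tensorM (R : realType) n (A B : 'I_n -> 'M[R[i]]_2) :
  tensor A *m tensor B = tensor (fun j => A j *m B j).
Proof.
apply/matrixP => r s; rewrite !mxE.
transitivity (\sum_(x : bits n) \prod_(j < n)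
    (A j (qubit_index (label r j)) (qubit_index (x j)) *
     B j (qubit_index (x j)) (qubit_index (label s j)))).
  rewrite (reindex (@enum_val _ {: bits n})); last first.
    by exists enum_rank => x _; rewrite ?enum_valK ?enum_rankK.
  by apply: eq_bigr => k _; rewrite !mxE big_split.
rewrite -(bigA_distr_bigA (fun j b =>
    A j (qubit_index (label r j)) (qubit_index b) *
     B j (qubit_index b) (qubit_index (label s j)))) /=.
apply: eq_bigr => j _; rewrite !mxE big_bool /= big_ord_recl big_ord1 addrC.
by congr (_ * _ + _ * _); congr (_ _ _); apply/val_inj.
Qed.

Lemma tensor1 (R : realType) n :
  tensor (fun _ : 'I_n => (1%:M : 'M[R[i]]_2)) = 1%:M.
Proof.
apply/matrixP => r s; rewrite !mxE; have [<-|rs] := eqVneq r s.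
  by rewrite big1 // => j _; rewrite !mxE eqxx.
have /existsP[j jrs] : [exists j, label r j != label s j].
  apply: contraR rs; rewrite negb_exists => /forallP H; apply/eqP/enum_val_inj.
  by apply/ffunP => j; apply/eqP; have := H j; rewrite negbK.
rewrite (bigD1 j) //= !mxE; case: (label r j) (label s j) jrs => [] [] //= _;
  by rewrite mul0r.
Qed.

Lemma pauliYY (R : realType) : pauliY R *m pauliY R = 1%:M.
Proof.
apply/matrixP => r s; rewrite !mxE big_ord_recl big_ord1 !mxE.
by case: r => [[|[|//]]] ?; case: s => [[|[|//]]] ?; apply/eqP;
  rewrite /= eq_complex /=; apply/andP; split; apply/eqP; ring.
Qed.

Lemma cos_piquarter (R : realType) : cos (pi / 4) = (Num.sqrt 2)^-1 :> R.
Proof.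
have h : 0 < cos (pi / 4) :> R.
  by apply: cos_gt0_pihalf; move: (pi : R) (pi_gt0 R) => p p0; apply/andP; split; lra.
have e : cos (pi / 4) ^+ 2 = 2^-1 :> R.
  have := cos_pihalf R; have -> : pi / 2 = (pi / 4) *+ 2 :> R by rewrite mulr2n; field.
  rewrite cos_mulr2n mulr2n => ?; lra.
by rewrite -sqrtrV // -e sqrtr_sqr gtr0_norm.
Qed.

Lemma sin_piquarter (R : realType) : sin (pi / 4) = (Num.sqrt 2)^-1 :> R.
Proof.
rewrite -cos_piquarter -cosBpihalf -cosN; congr cos; by field.
Qed.

(* Partial sums of the exponential series of - (i pi / 4) Y^{(x) n}. *)
Definition exp_entangler_sum (R : realType) n N : 'M[R[i]]_(qdim n) :=
  \sum_(0 <= k < N) (k`!%:R^-1)%:C *: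
     (- ('i * (pi / 4)%:C) *: tensor (fun _ : 'I_n => pauliY R)) ^+ k.

Lemma exp_entangler_sumE (R : realType) n N :
  exp_entangler_sum R n N = (series (cos_coeff (pi / 4)) N)%:C *: 1%:M
   - ('i * (series (sin_coeff (pi / 4)) N)%:C) *: tensor (fun _ : 'I_n => pauliY R).
Proof.
set Y := tensor _; set a : R := pi / 4.
have YY : Y * Y = 1.
  rewrite /Y -mulmxE tensorM -[1]tensor1; congr tensor.
  by apply/boolp.funext => j; exact: pauliYY.
have ii : 'i * 'i = -1 :> R[i].
  by apply/eqP; rewrite eq_complex /=; apply/andP; split; apply/eqP; ring.
rewrite /exp_entangler_sum /series /= !rmorph_sum /= mulr_sumr !scaler_suml -sumrB.
apply: eq_bigr => k _.
have c2 : (- ('i * a%:C)) ^+ 2 = ((-1) * a ^+ 2)%:C :> R[i].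
  rewrite sqrrN exprMn (expr2 'i) ii; apply/eqP; rewrite eq_complex expr2 /= .
  by apply/andP; split; apply/eqP; ring.
have expZ c : (c *: Y) ^+ k = c ^+ k *: Y ^+ k.
  elim: k => [|k IH]; first by rewrite !expr0 scale1r.
  by rewrite !exprS IH -!mulmxE -scalemxAl -scalemxAr scalerA.
rewrite expZ scalerA /sin_coeff /cos_coeff /=.
have Yk : Y ^+ k = if odd k then Y else 1.
  rewrite -[in LHS](odd_double_half k) exprD -mul2n exprM expr2 YY expr1n mulr1.
  by case: (odd k).
have ck : (- ('i * a%:C)) ^+ k
    = (if odd k then - 'i else 1) * ((-1) ^+ k./2 * a ^+ k)%:C :> R[i].
  rewrite -[in LHS](odd_double_half k) -[k in a ^+ k](odd_double_half k).
  rewrite !exprD -mul2n !exprM c2 -!rmorphXn exprMn /=.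
  case: (odd k); rewrite ?expr0 ?expr1 ?mul1r //.
  by rewrite !rmorphM /=; ring.
have odk : odd k -> k.-1./2 = k./2.
  by case: k {Yk ck expZ} => //= k ok; rewrite uphalf_half -[odd k]negbK ok.
rewrite Yk ck; case ok: (odd k) odk => odk /=.
  rewrite !(mulr0n, mulr1n, mul0r) rmorph0 scale0r sub0r -scaleNr odk // mul1r.
  congr (_ *: _); rewrite !rmorphM /=; ring.
rewrite !(mulr0n, mulr1n, mul0r) rmorph0 mulr0 scale0r subr0 !mul1r.
congr (_ *: _); rewrite -rmorphM; congr (_%:C); rewrite -exprnP; ring.
Qed.

Lemma cvg_exp_entangler (R : realType) n (r s : 'I_(qdim n)) :
  (fun N => complex.Re (exp_entangler_sum R n N r s)) @ \oo
    --> complex.Re (entangler R n r s) /\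
  (fun N => complex.Im (exp_entangler_sum R n N r s)) @ \oo
    --> complex.Im (entangler R n r s).
Proof.
set y := tensor (fun _ => pauliY R) r s; set d : R := (r == s)%:R.
have cC : series (cos_coeff (pi / 4)) @ \oo --> ((Num.sqrt 2)^-1 : R).
  by rewrite -cos_piquarter; rewrite unlock; exact: is_cvg_series_cos_coeff.
have cS : series (sin_coeff (pi / 4)) @ \oo --> ((Num.sqrt 2)^-1 : R).
  by rewrite -sin_piquarter; rewrite unlock; exact: is_cvg_series_sin_coeff.
have E N : exp_entangler_sum R n N r s =
    (series (cos_coeff (pi / 4)) N * d
      + series (sin_coeff (pi / 4)) N * complex.Im y)
    +i* (- series (sin_coeff (pi / 4)) N * complex.Re y).
  rewrite exp_entangler_sumE /y /d; move: (tensor _) => Y; rewrite !mxE; case: (Y r s) => a b.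
  by apply/eqP; rewrite eq_complex; case: (r == s) => /=;
    apply/andP; split; apply/eqP => /=; ring.
have EJ : entangler R n r s =
    ((Num.sqrt 2)^-1 * d + (Num.sqrt 2)^-1 * complex.Im y)
    +i* (- (Num.sqrt 2)^-1 * complex.Re y).
  rewrite /entangler /y /d; move: (tensor _) => Y; rewrite !mxE; case: (Y r s) => a b.
  by apply/eqP; rewrite eq_complex; case: (r == s) => /=;
    apply/andP; split; apply/eqP => /=; ring.
rewrite EJ /=; split.
  under boolp.eq_fun do rewrite E /=.
  by apply: cvgD; apply: cvgMr_tmp.
under boolp.eq_fun do rewrite E /=.
by apply: cvgMr_tmp; apply: cvgN.
Qed.

(* Main.v *)
(* Since Y|y> is i^n (-1)^wt(y) |compl y> on n qubits, J maps a basis state to a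
   combination of itself and its complement.  Hence the amplitude at x is a
   combination of the four entries of the tensor product of the U's in rows x,
   compl x and columns 0^n, 1^n, and these pair up to
     (-1)^wt(compl x) c(x) - i^n s(x).
   For odd n the two terms are orthogonal in the complex plane; for even n both
   are real and their product is the interference term. *)
Require Import Defs.
From mathcomp Require Import all_boot all_order all_algebra.
From mathcomp Require Import reals trigo.
From mathcomp Require Import complex ring.

Set Implicit Arguments.
Unset Strict Implicit.
Unset Printing Implicit Defensive.

Import Order.TTheory GRing.Theory Num.Theory.
Local Open Scope ring_scope.
Local Open Scope complex_scope.
Local Open Scope sesquilinear_scope.

(** * Weights and complements of bit strings *)

Lemma wt_sum n (x : bits n) : wt x = (\sum_j x j)%N.
Proof.
by rewrite /wt -sum1dep_card big_mkcond; apply: eq_bigr => j _; case: (x j).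
Qed.

Lemma wt_le n (x : bits n) : (wt x <= n)%N.
Proof. by rewrite -[leqRHS]card_ord max_card. Qed.

Lemma wt_gt0 n (x : bits n) i : x i -> (0 < wt x)%N.
Proof. by move=> xi; apply/card_gt0P; exists i; rewrite inE. Qed.

Lemma wt_eq0 n (x : bits n) : (wt x == 0)%N = (x == zeros n).
Proof.
apply/eqP/eqP => [x0|->]; last by rewrite wt_sum big1 // => j _; rewrite ffunE.
apply/ffunP => j; rewrite ffunE; apply/negP => /wt_gt0.
by rewrite x0.
Qed.

Lemma complK n : involutive (@compl n).
Proof. by move=> x; apply/ffunP => j; rewrite !ffunE negbK. Qed.

Lemma wt_compl n (x : bits n) : (wt (compl x) + wt x = n)%N.
Proof.
rewrite !wt_sum -big_split -[RHS]card_ord -sum1_card /=.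
by apply: eq_bigr => j _; rewrite ffunE; case: (x j).
Qed.

Lemma prod_sign (A : comPzRingType) n (x : bits n) :
  \prod_j (-1) ^+ x j = (-1) ^+ wt x :> A.
Proof. by rewrite wt_sum expr_sum. Qed.

Lemma prod_bits (A : comPzRingType) n (x : bits n) (f g : 'I_n -> A) :
  \prod_j (if x j then f j else g j) =
    (\prod_(j | ~~ x j) g j) * \prod_(j | x j) f j.
Proof.
rewrite (bigID x) /= mulrC; congr (_ * _); apply: eq_bigr => j.
  by move/negbTE->.
by move->.
Qed.

Section Qubits.
Variables (R : realType) (n : nat).
Implicit Types (x y : bits n).

(** * Phases and tensor entries *)

Lemma cis0 : cis 0 = 1 :> R[i].
Proof. by rewrite /cis cos0 sin0. Qed.

Lemma cisD (a b : R) : cis (a + b) = cis a * cis b.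
Proof.
rewrite /cis cosD sinD; apply/eqP; rewrite eq_complex /= eqxx /=.
by apply/eqP; ring.
Qed.

Lemma prod_cis (P : pred 'I_n) (a : 'I_n -> R) :
  \prod_(j | P j) cis (a j) = cis (\sum_(j | P j) a j).
Proof. by apply/esym/(big_morph _ cisD cis0). Qed.

Lemma mx2E (C : Type) (a b c d : C) (p q : bool) :
  mx2 a b c d (qubit_index p) (qubit_index q) =
    if p then (if q then d else c) else (if q then b else a).
Proof. by rewrite mxE; case: p; case: q. Qed.

Lemma tensorE (A : 'I_n -> 'M[R[i]]_2) x y :
  tensor A (enum_rank x) (enum_rank y) =
    \prod_j A j (qubit_index (x j)) (qubit_index (y j)).
Proof. by rewrite mxE /label !enum_rankK. Qed.

(** * Action of the entangler on basis states *)

Lemma bra_mul_ket (M : 'M[R[i]]_(qdim n)) x y :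
  (bra R x *m M *m ket R y) 0 0 = M (enum_rank x) (enum_rank y).
Proof.
by rewrite /bra /ket trmx_delta map_delta_mx -rowE -colE !mxE.
Qed.

(* A bare 'i below an algebraic operation would be read as [Num.imaginary], which
   is convertible but not syntactically equal to 'i%C. *)
Lemma pauliY_ket y :
  tensor (fun _ : 'I_n => pauliY R) *m ket R y
    = ('i%C ^+ n * (-1) ^+ wt y) *: ket R (compl y).
Proof.
apply/matrixP => r c; rewrite -colE [c]ord1 mxE -[r]enum_valK tensorE.
set x := enum_val r; rewrite !mxE (inj_eq enum_rank_inj) andbT.
have [->|xy] := eqVneq.
  have -> : 'i%C ^+ n = \prod_(j < n) 'i%C :> R[i] by rewrite prodr_const card_ord.
  rewrite mulr1 -prod_sign -big_split /=.
  by apply: eq_bigr => j _; rewrite mx2E ffunE; case: (y j);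
    rewrite ?mulrN1 ?mulr1.
(* If [x] is not the complement of [y], they agree at some [j], and the zero diagonal of [pauliY]
   kills the product. *)
have /existsP[j xj] : [exists j, x j == y j].
  apply: contraR xy; rewrite negb_exists => /forallP H; apply/eqP/ffunP => j.
  by rewrite ffunE; move: (H j); case: (x j) (y j) => [] [].
by rewrite mulr0 (bigD1 j) //= mx2E (eqP xj); case: (y j); rewrite mul0r.
Qed.

Lemma entangler_ket y :
  entangler R n *m ket R y = ((Num.sqrt 2)^-1)%:C *:
    (ket R y - ('i%C ^+ n.+1 * (-1) ^+ wt y) *: ket R (compl y)).
Proof.
rewrite /entangler -scalemxAl mulmxBl mul1mx -scalemxAl pauliY_ket.
by rewrite scalerA mulrA -exprS.
Qed.

Lemma conj_i : Num.conj ('i%C : R[i]) = - 'i%C.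
Proof. by apply/eqP; rewrite eq_complex /= oppr0 !eqxx. Qed.

(** The adjoint of [entangler_ket]: conjugation fixes the real scalars and the sign, and turns i
    into -i. *)
Lemma bra_entangler x :
  bra R x *m (entangler R n) ^t* = ((Num.sqrt 2)^-1)%:C *:
    (bra R x - ((- 'i%C) ^+ n.+1 * (-1) ^+ wt x) *: bra R (compl x)).
Proof.
rewrite -map_mxM -trmx_mul entangler_ket linearZ /= map_mxZ; congr (_ *: _).
  exact: conjc_real.
rewrite linearB linearZ /= map_mxB map_mxZ; congr (_ - _ *: _).
rewrite rmorphM !rmorphXn rmorphN rmorph1; congr (_ ^+ _ * _).
exact: conj_i.
Qed.

(** * Gate entries and the amplitude *)

Variables theta phi : 'I_n -> R.
Let U := tensor (fun j => gateU (theta j) (phi j)).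

(** In the first column of a gate, a 0 of [x] contributes a phase and a cosine, a 1 contributes
    minus a sine. *)
Lemma gateU_col0 x : U (enum_rank x) (enum_rank (zeros n)) =
  (-1) ^+ wt x * cis (\sum_(j | ~~ x j) phi j) *
  (\prod_(j | ~~ x j) cos (theta j / 2) * \prod_(j | x j) sin (theta j / 2))%:C.
Proof.
rewrite tensorE -prod_cis rmorphM !rmorph_prod /=.
transitivity (\prod_j (-1) ^+ x j * \prod_j (if x j then (sin (theta j / 2))%:C
    else cis (phi j) * (cos (theta j / 2))%:C)).
  rewrite -big_split; apply: eq_bigr => j _ /=; rewrite mx2E ffunE.
  by case: (x j); rewrite ?mulN1r ?mul1r.
by rewrite prod_sign prod_bits big_split /= !mulrA.
Qed.

Lemma gateU_col1 x : U (enum_rank x) (enum_rank (compl (zeros n))) =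
  cis (- \sum_(j | x j) phi j) *
  (\prod_(j | ~~ x j) sin (theta j / 2) * \prod_(j | x j) cos (theta j / 2))%:C.
Proof.
rewrite tensorE -sumrN -prod_cis rmorphM !rmorph_prod /=.
transitivity (\prod_j (if x j then cis (- phi j) * (cos (theta j / 2))%:C
    else (sin (theta j / 2))%:C)).
  by apply: eq_bigr => j _ /=; rewrite mx2E !ffunE; case: (x j).
by rewrite prod_bits big_split /= mulrCA.
Qed.

Lemma amplitude_entries x : amplitude theta phi x =
  2^-1 * (U (enum_rank (compl x)) (enum_rank (zeros n))
    - (- 'i%C) ^+ n.+1 * (-1) ^+ wt (compl x)
      * U (enum_rank x) (enum_rank (zeros n))
    - 'i%C ^+ n.+1 * (U (enum_rank (compl x)) (enum_rank (compl (zeros n)))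
    - (- 'i%C) ^+ n.+1 * (-1) ^+ wt (compl x)
      * U (enum_rank x) (enum_rank (compl (zeros n))))).
Proof.
rewrite /amplitude -[_ *m entangler R n *m _]mulmxA entangler_ket bra_entangler.
rewrite complK -/U.
have -> : wt (zeros n) = 0%N by apply/eqP; rewrite wt_eq0.
rewrite mulr1.
(* One normalising factor comes from each of the two entanglers. *)
have s2 : ((Num.sqrt 2)^-1)%:C * ((Num.sqrt 2)^-1)%:C = 2^-1 :> R[i].
  by rewrite -rmorphM /= -invfM -expr2 sqr_sqrtr // fmorphV rmorph_nat.
rewrite -!scalemxAl -scalemxAr scalerA s2 mulmxBr !mulmxBl -!scalemxAl.
rewrite -!scalemxAr.
set r := _ * _; rewrite -!bra_mul_ket; move: (bra R x) (bra R _) => b b'.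
by rewrite !mxE; ring.
Qed.

(** Entries (compl x, 0^n) and (x, 1^n) have conjugate phases and the same trigonometric product;
    they add up to twice a cosine. The other two entries are subtracted and give 2i times a sine, so
    i^(n+1) becomes -i^n. *)
Lemma amplitudeE x : amplitude theta phi x =
  ((-1) ^+ wt (compl x) * cfun theta phi x)%:C - 'i%C ^+ n * (sfun theta phi x)%:C.
Proof.
have cx (V : Type) (idx : V) op F :
    \big[op/idx]_(j | compl x j) F j = \big[op/idx]_(j | ~~ x j) F j.
  by apply: eq_bigl => j; rewrite ffunE.
have ncx (V : Type) (idx : V) op F :
    \big[op/idx]_(j | ~~ compl x j) F j = \big[op/idx]_(j | x j) F j.
  by apply: eq_bigl => j; rewrite ffunE negbK.
rewrite amplitude_entries !gateU_col0 !gateU_col1 !cx !ncx /cfun /sfun.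
have cisE c : cis c = (cos c)%:C + 'i%C * (sin c)%:C :> R[i].
  exact: complexE.
rewrite !exprS !cisE !cosN !sinN !(rmorphM, rmorphN, rmorphXn, rmorph1) /=.
have ii : 'i%C * 'i%C = -1 :> R[i] by rewrite -expr2 sqr_i.
have sb2 : (-1) ^+ wt (compl x) * (-1) ^+ wt (compl x) = 1 :> R[i].
  by rewrite -expr2 sqrr_sign.
have sx2 : (-1) ^+ wt x * (-1) ^+ wt x = 1 :> R[i].
  by rewrite -expr2 sqrr_sign.
have sbx : (-1) ^+ wt (compl x) * (-1) ^+ wt x = (-1) ^+ n :> R[i].
  by rewrite -exprD wt_compl.
have uu : (-1) ^+ n * ('i%C ^+ n * 'i%C ^+ n) = 1 :> R[i].
  by rewrite -!exprMn ii mulrNN mulr1 expr1n.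
rewrite (exprNn 'i%C) -sbx; rewrite -sbx in uu.
apply: (mulfI (x := 2)); first by rewrite pnatr_eq0.
rewrite mulVKf ?pnatr_eq0 //.
move: ii sb2 sx2 uu.
set I := 'i%C; set u := _ ^+ n; set q := _ ^+ wt _; set p := _ ^+ wt _.
move: I u q p => I u q p ii qq pp uu.
(* Reducing q^2 to 1 in the goal leaves p u^2 without the factor q, so the relation is solved for
   that monomial. *)
have {}uu : p * (u * u) = q by rewrite -[RHS]mulr1 -uu; ring: qq.
ring: ii qq pp uu.
Qed.

(** * Probabilities and payoffs *)

Lemma sqr_normcE (z : R[i]) :
  Normc.normc z ^+ 2 = complex.Re z ^+ 2 + complex.Im z ^+ 2.
Proof. by case: z => a b; rewrite /= sqr_sqrtr // addr_ge0 // sqr_ge0. Qed.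

Lemma probE x : prob theta phi x =
  cfun theta phi x ^+ 2 + sfun theta phi x ^+ 2
  - 2 * (-1) ^+ (n./2 + wt x) * tfun theta phi x * (~~ odd n)%:R.
Proof.
rewrite /prob amplitudeE sqr_normcE /tfun.
set c := cfun _ _ _; set s := sfun _ _ _.
(* Extracting the sign leaves i for odd n and 1 for even n, which decides whether the [sfun] term is
   imaginary or real. *)
have in2 : 'i%C ^+ n = ((-1) ^+ n./2)%:C * 'i%C ^+ odd n :> R[i].
  rewrite -[in LHS](odd_double_half n) exprD -mul2n exprM sqr_i mulrC.
  by rewrite rmorphXn rmorphN rmorph1.
rewrite in2; case: (boolP (odd n)) => on /=; simpc => /=.
  by rewrite sqrrN !exprMn !sqrr_sign !mul1r.
rewrite expr0n addr0 sqrrB !exprMn !sqrr_sign !mul1r exprD.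
(* The two weights sum to the even number n, so they have the same parity. *)
have -> : (-1) ^+ wt (compl x) = (-1) ^+ wt x :> R.
  rewrite -signr_odd -[RHS]signr_odd; congr (_ ^+ nat_of_bool _).
  by move: on; rewrite -[n in odd n](wt_compl x) oddD; do 2!case: odd.
by rewrite -mulr_natl; ring.
Qed.

(** Only the payoff table matters, whatever the values of [prob]: split on bit i, drop the all-zeros
    string, which pays 0, and group volunteering profiles by weight. *)
Lemma payoffE i : payoff theta phi i =
  2 * (\sum_(x : bits n | (x != zeros n) && ~~ x i) prob theta phi x)
  + \sum_(1 <= k < n.+1)
      (2 - k%:R^-1) *
      (\sum_(x : bits n | x i && (wt x == k)) prob theta phi x).
Proof.
rewrite /payoff (bigID (fun x : bits n => x i)) /= addrC; congr (_ + _).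
  rewrite mulr_sumr (bigID (fun x => x == zeros n)) /= big1 ?add0r.
    under [RHS]eq_bigl do rewrite andbC.
    apply: eq_bigr => x /andP[xi x0].
    by rewrite /vd_payoff (negbTE xi) lt0n wt_eq0 x0 mulr1.
  move=> x /andP[/negbTE xi x0].
  by rewrite /vd_payoff xi lt0n wt_eq0 x0 mulr0 mul0r.
under [RHS]eq_bigr do rewrite mulr_sumr.
rewrite (exchange_big_dep (fun x : bits n => x i)) => [/=|k x _ /andP[]//].
apply: eq_bigr => x xi; under eq_bigl do rewrite xi /= eq_sym.
(* For fixed [x] only k = [wt x] survives; it is in range since bit i makes the weight positive. *)
by rewrite big_nat1_eq (wt_gt0 xi) ltnS wt_le /vd_payoff xi.
Qed.

End Qubits.

Theorem lemma7 (R : realType) (n : nat) (theta phi : 'I_n -> R)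
    (hn : (2 <= n)%N)
    (hTheta : forall j : 'I_n, in_Theta (theta j) (phi j))
    (i : 'I_n) :
  payoff theta phi i =
    2 * (\sum_(x : bits n | (x != zeros n) && ~~ x i) prob theta phi x)
    + \sum_(1 <= k < n.+1)
        (2 - k%:R^-1) *
        (\sum_(x : bits n | x i && (wt x == k)) prob theta phi x)
  /\
  forall x : bits n,
    prob theta phi x =
      cfun theta phi x ^+ 2 + sfun theta phi x ^+ 2
      - 2 * (-1) ^+ (n./2 + wt x) * tfun theta phi x * (~~ odd n)%:R.
Proof. by split; [exact: payoffE | exact: probE]. Qed.
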